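(* Let $S$ be a numerical semigroup, let $a\in S$ be nonzero, and let $m$ be a positive integer with $\gcd(a,m)=1$. Then the following statements are equivalent. (1) The set of gaps $\mathrm{H}(S)$ is equidistributed modulo $m$. (2) $\mathrm{P}_{\mathrm{H}(S)}(x)\in\langle \mathrm{C}_m(x)\rangle$, the principal ideal of $\mathbb{Z}[x]$ generated by $\mathrm{C}_m(x)$. (3) $\sum_{n\in\mathrm{Ap}(S;a)}x^n \equiv \sum_{n=0}^{a-1}x^n \pmod{(x^m-1)}$ in $\mathbb{Z}[x]$. (4) $\sum_{n\in\mathrm{Ap}(S;a)\setminus\{0\}}x^n \equiv \sum_{n=1}^{a-1}x^n \pmod{(x^m-1)}$ in $\mathbb{Z}[x]$. (5) $\mathrm{Ap}(S;a)\equiv[0,a-1]\pmod{m}$ (multiset congruence). (6) $\mathrm{Ap}(S;a)\setminus\{0\}\equiv[1,a-1]\pmod{m}$ (multiset congruence).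
   Context: A numerical semigroup is a submonoid $S$ of $(\mathbb{N}_0,+)$, $\mathbb{N}_0=\{0,1,2,\dots\}$, with finite complement; $\mathrm{H}(S)=\mathbb{N}_0\setminus S$ is its set of gaps. For nonzero $a\in S$, the Apéry set is $\mathrm{Ap}(S;a)=\{s\in S: s-a\notin S\}$. For a finite multiset $A$ of integers, $\mathrm{n}_{r,m}(A)$ is the number of elements of $A$ (counted with multiplicity) congruent to $r$ modulo $m$. $A$ is equidistributed modulo $m$ if $\mathrm{n}_{r_1,m}(A)=\mathrm{n}_{r_2,m}(A)$ for all $r_1,r_2\in\{1,\dots,m\}$. Two finite multisets of integers satisfy $A\equiv B\pmod{m}$ if $\mathrm{n}_{r,m}(A)=\mathrm{n}_{r,m}(B)$ for all $r\in\{1,\dots,m\}$. For a finite multiset $A\subset\mathbb{N}_0$, $\mathrm{P}_A(x)=\sum_{n\in A}x^n\in\mathbb{Z}[x]$. $\mathrm{C}_m(x)=\sum_{r=0}^{m-1}x^r$. $[u,v]$ denotes the set of integers $n$ with $u\le n\le v$ (empty if $u>v$). Polynomial congruence $f\equiv g\pmod{h}$ means $f-g\in h(x)\mathbb{Z}[x]$. *)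

(* Defs.v *)
From mathcomp Require Import all_boot all_order all_algebra.
From mathcomp Require Import finmap multiset.
From mathcomp Require Import all_classical.

Set Implicit Arguments.
Unset Strict Implicit.
Unset Printing Implicit Defensive.

Import Order.TTheory GRing.Theory Num.Theory.

Local Open Scope mset_scope.
Local Open Scope classical_set_scope.
Local Open Scope ring_scope.

Record numerical_semigroup (S : set nat) : Prop := NumericalSemigroup {
  nsg0 : S 0%N;
  nsgD : forall s t, S s -> S t -> S (s + t)%N;
  nsg_cofinite : finite_set (~` S) }.

Definition gaps (S : set nat) : set nat := ~` S.

(* The guard [a <= s] is needed because [s - a] is truncated: an element [s]
   of [S] smaller than [a] belongs to the Apery set. *)
Definition Apery (S : set nat) (a : nat) : set nat :=
  [set s | S s /\ ~ ((a <= s)%N /\ S (s - a)%N)].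

Lemma finite_gaps (S : set nat) : numerical_semigroup S -> finite_set (gaps S).
Proof. by case. Qed.

Lemma finite_Apery (S : set nat) (a : nat) :
  numerical_semigroup S -> finite_set (Apery S a).
Proof.
move=> nS; apply: (@sub_finite_set _ _ (`I_a `|` addn a @` gaps S)); last first.
  rewrite finite_setU; split; first exact: finite_II.
  exact/finite_image/finite_gaps.
move=> s [_ nSsa]; have [lt_sa|le_as] := ltnP s a; first by left.
by right; exists (s - a)%N; [move=> Ssa; apply: nSsa | rewrite subnKC].
Qed.

(* A finite set viewed as a multiset; [fset_set A] is [A] when [A] is finite
   and a junk value (the empty set) otherwise. *)
Definition mset_of (T : choiceType) (A : set T) : {mset T} :=
  seq_mset (fset_set A).

Definition intset (A : set nat) : set int := Posz @` A.

Definition int_interval (u v : int) : set int := [set n | u <= n <= v].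

Lemma finite_int_interval (u v : int) : finite_set (int_interval u v).
Proof.
apply: (@sub_finite_set _ _ ((fun n : nat => u + n%:Z) @` `I_`|v - u|%N.+1)).
  move=> x /andP[le_ux le_xv]; exists `|x - u|%N; last first.
    by rewrite gez0_abs ?subr_ge0 // addrCA subrr addr0.
  rewrite /= ltnS -lez_nat !gez0_abs ?subr_ge0 ?lerD2r //.
  exact: le_trans le_xv.
exact/finite_image/finite_II.
Qed.

Definition nres (r : int) (m : nat) (A : {mset int}) : nat :=
  count (fun x : int => (x == r %[mod m])%Z) A.

Definition equidistributed (m : nat) (A : {mset int}) : Prop :=
  forall r1 r2 : nat, (1 <= r1 <= m)%N -> (1 <= r2 <= m)%N ->
    nres r1 m A = nres r2 m A.

Definition mset_congr (m : nat) (A B : {mset int}) : Prop :=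
  forall r : nat, (1 <= r <= m)%N -> nres r m A = nres r m B.

Definition mset_poly (A : {mset nat}) : {poly int} := \sum_(n <- A) 'X^n.

Definition allones_poly (m : nat) : {poly int} := \sum_(0 <= r < m) 'X^r.

(* The library's divisibility [%|] on polynomials is a pseudo-division, i.e.
   divisibility up to a nonzero integer factor over [int]; ideal membership
   and congruence are therefore stated with an explicit cofactor in Z[x]. *)
Definition principal_ideal (h : {poly int}) : set {poly int} :=
  [set f | exists q : {poly int}, f = h * q].

Definition poly_congr (h f g : {poly int}) : Prop := principal_ideal h (f - g).

(* Main.v *)
(* The generating functions satisfy
     P_Ap(S;a) - (1 + X + ... + X^(a-1)) = (X^a - 1) P_H(S),
   by comparing Ap(S;a) + H(S) with (a + H(S)) + [0, a-1] as multisets.  Since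
   gcd(a, m) = 1, X - 1 lies in the ideal generated by X^a - 1 and X^m - 1, so
   X^m - 1 = (X - 1) C_m divides (X^a - 1) P_H iff C_m divides P_H.  Reducing
   exponents modulo m turns both divisibilities into statements about residue
   counts: modulo X^m - 1 a polynomial of degree < m is determined, and such a
   polynomial is a multiple of C_m iff its coefficients are constant. *)

Require Import Defs.
From mathcomp Require Import all_boot all_order all_algebra.
From mathcomp Require Import finmap multiset.
From mathcomp Require Import all_classical.
From mathcomp Require Import zify ring.

Set Implicit Arguments.
Unset Strict Implicit.
Unset Printing Implicit Defensive.

Import Order.TTheory GRing.Theory Num.Theory.

Local Open Scope classical_set_scope.
Local Open Scope ring_scope.

(** * Ideals and congruences in Z[x] *)

Lemma principal_idealD (h f g : {poly int}) :
  principal_ideal h f -> principal_ideal h g -> principal_ideal h (f + g).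
Proof. by move=> [p ->] [q ->]; exists (p + q); rewrite mulrDr. Qed.

Lemma principal_idealMl (h f g : {poly int}) :
  principal_ideal h g -> principal_ideal h (f * g).
Proof. by move=> [q ->]; exists (f * q); rewrite mulrCA. Qed.

Lemma principal_idealN (h f : {poly int}) :
  principal_ideal h f -> principal_ideal h (- f).
Proof. by move=> [q ->]; exists (- q); rewrite mulrN. Qed.

Lemma poly_congr_sym (h f g : {poly int}) :
  poly_congr h f g -> poly_congr h g f.
Proof. by rewrite /poly_congr -[g - f]opprB; exact: principal_idealN. Qed.

Lemma poly_congr_trans (h f g k : {poly int}) :
  poly_congr h f g -> poly_congr h g k -> poly_congr h f k.
Proof.
by rewrite /poly_congr -(subrKA g f (- k)); exact: principal_idealD.
Qed.

Lemma poly_congr_ideal (h f g : {poly int}) :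
  poly_congr h f g -> principal_ideal h f <-> principal_ideal h g.
Proof.
move=> fg; split=> [hf|hg]; last first.
  by rewrite -(subrK g f); exact: principal_idealD.
by rewrite -(subrK f g); apply: principal_idealD => //; exact: poly_congr_sym.
Qed.

(** For monic [h] sizes add up as over a field: [size (h * q)] is [size h + size q - 1] when [q] is
    nonzero, so the size bound leaves only a constant cofactor. It replaces uniqueness of remainders
    in division by [h]. *)
Lemma principal_ideal_size_le (h f : {poly int}) :
  h \is monic -> principal_ideal h f -> (size f <= size h)%N ->
  exists c : int, f = c *: h.
Proof.
move=> mh [q ->]; have [->|q0] := eqVneq q 0.
  by exists 0; rewrite mulr0 scale0r.
rewrite size_monicM // => le_hq.
have h0 : (0 < size h)%N by rewrite size_poly_gt0 monic_neq0.
have /size1_polyC-> : (size q <= 1)%N by lia.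
by exists q`_0; rewrite mulrC mul_polyC.
Qed.

Lemma principal_ideal_size_lt (h f : {poly int}) :
  h \is monic -> principal_ideal h f -> (size f < size h)%N -> f = 0.
Proof.
move=> mh hf lt_fh; have [c fE] := principal_ideal_size_le mh hf (ltnW lt_fh).
have [c0|c0] := eqVneq c 0; first by rewrite fE c0 scale0r.
by rewrite fE size_scale // ltnn in lt_fh.
Qed.

(** * Residue counts as remainders modulo X^m - 1 *)

Lemma principal_ideal_Xn_sub1 (m k : nat) :
  principal_ideal ('X^m - 1) ('X^(m * k) - 1).
Proof. by exists (\sum_(i < k) ('X^m) ^+ i); rewrite exprM subrX1. Qed.

Lemma allones_polyE (m : nat) : allones_poly m = \poly_(r < m) 1.
Proof.
rewrite poly_def /allones_poly big_mkord.
by apply: eq_bigr => i _; rewrite scale1r.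
Qed.

Lemma Xn_sub1E (m : nat) : 'X^m - 1 = ('X - 1) * allones_poly m :> {poly int}.
Proof. by rewrite subrX1 /allones_poly big_mkord. Qed.

Lemma size_allones_poly (m : nat) : size (allones_poly m) = m.
Proof. by rewrite allones_polyE size_poly_eq // oner_neq0. Qed.

Lemma allones_poly_monic (m : nat) : (0 < m)%N -> allones_poly m \is monic.
Proof. by move=> m0; rewrite monicE allones_polyE lead_coef_poly // oner_neq0. Qed.

Definition residue_count (m : nat) (s : seq nat) (r : nat) : nat :=
  count (fun n => n == r %[mod m]) s.

Lemma residue_count_mod (m : nat) (s : seq nat) (r : nat) :
  residue_count m s (r %% m) = residue_count m s r.
Proof. by apply: eq_count => n; rewrite /= modn_mod. Qed.

(** For positive [m], this is the remainder of the generating polynomial of [s] in the division by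
    X^m - 1. *)
Definition residue_poly (m : nat) (s : seq nat) : {poly int} :=
  \poly_(r < m) (residue_count m s r)%:Z.

Lemma poly_congr_residue (m : nat) (s : seq nat) : (0 < m)%N ->
  poly_congr ('X^m - 1) (\sum_(n <- s) 'X^n) (residue_poly m s).
Proof.
move=> m0; elim: s => [|n s IHs].
  rewrite big_nil; exists 0; rewrite mulr0 sub0r; apply/eqP; rewrite oppr_eq0.
  by apply/eqP/polyP => i; rewrite coef_poly coef0 if_same.
have -> : residue_poly m (n :: s) = 'X^(n %% m) + residue_poly m s.
  apply/polyP => i; rewrite coefD coefXn !coef_poly /residue_count /=.
  case: ltnP => [lt_im|le_mi]; first by rewrite PoszD (modn_small lt_im) eq_sym; case: eqP.
  rewrite addr0; case: eqP => // im.
  by have := ltn_pmod n m0; rewrite -im ltnNge le_mi.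
rewrite big_cons /poly_congr opprD addrACA; apply: principal_idealD => //.
(* Lowering the exponent to its residue costs a multiple of X^(mk) - 1, with k the quotient of [n]
   by [m], hence a multiple of X^m - 1. *)
have -> : 'X^n - 'X^(n %% m) = 'X^(n %% m) * ('X^(m * (n %/ m)) - 1) :> {poly int}.
  by rewrite mulrBr mulr1 -exprD mulnC addnC -divn_eq.
exact/principal_idealMl/principal_ideal_Xn_sub1.
Qed.

(** Both sums may be replaced by their remainders. The difference of these has degree below [m], so
    it is a multiple of X^m - 1 only if it vanishes, and its coefficients compare the counts. *)
Lemma poly_congr_Xn_sub1P (m : nat) (s t : seq nat) : (0 < m)%N ->
  poly_congr ('X^m - 1) (\sum_(n <- s) 'X^n) (\sum_(n <- t) 'X^n) <->
  residue_count m s =1 residue_count m t.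
Proof.
move=> m0; have Ps := poly_congr_residue s m0; have Pt := poly_congr_residue t m0.
split=> [st|st]; last first.
  apply: poly_congr_trans Ps _; apply: poly_congr_sym.
  suff -> : residue_poly m s = residue_poly m t by [].
  by apply/polyP => i; rewrite !coef_poly st.
have /eqP : residue_poly m s - residue_poly m t = 0.
  apply: (@principal_ideal_size_lt ('X^m - 1)); first exact: monicXnsubC.
    by apply: poly_congr_trans (poly_congr_sym Ps) _; exact: poly_congr_trans st Pt.
  rewrite size_XnsubC // ltnS (leq_trans (size_polyD _ _)) // size_polyN.
  by rewrite geq_max !size_poly.
rewrite subr_eq0 => /eqP/polyP eq_st r; have := eq_st (r %% m)%N.
by rewrite !coef_poly ltn_pmod // !residue_count_mod => -[].
Qed.

(** C_m divides X^m - 1, so the remainder modulo X^m - 1 can again stand for the sum. Its size is at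
    most [m], the size of C_m, so it lies in the ideal only as an integer multiple of C_m, that is,
    with constant coefficients. *)
Lemma allones_poly_idealP (m : nat) (s : seq nat) : (0 < m)%N ->
  principal_ideal (allones_poly m) (\sum_(n <- s) 'X^n) <->
  forall r1 r2, residue_count m s r1 = residue_count m s r2.
Proof.
move=> m0.
have s_res :
    poly_congr (allones_poly m) (\sum_(n <- s) 'X^n) (residue_poly m s).
  have [q sq] := poly_congr_residue s m0.
  by exists (('X - 1) * q); rewrite sq Xn_sub1E mulrCA mulrA.
apply: iff_trans (poly_congr_ideal s_res) _; split=> [|st]; last first.
  exists (residue_count m s 0)%:Z%:P; rewrite mulrC mul_polyC.
  apply/polyP => i; rewrite coefZ allones_polyE !coef_poly (st i 0%N).
  by case: ifP; rewrite ?mulr1 ?mulr0.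
move/(principal_ideal_size_le (allones_poly_monic m0)).
rewrite size_allones_poly => /(_ (size_poly _ _))[c /polyP cE].
suff cr r : (residue_count m s r)%:Z = c.
  by move=> r1 r2; apply/eqP; rewrite -eqz_nat !cr.
have := cE (r %% m)%N.
by rewrite coefZ allones_polyE !coef_poly ltn_pmod // mulr1 residue_count_mod.
Qed.

Lemma coprime_allones_poly_ideal (a m : nat) (f : {poly int}) :
  (0 < a)%N -> coprime a m ->
  principal_ideal ('X^m - 1) (('X^a - 1) * f) <->
  principal_ideal (allones_poly m) f.
Proof.
move=> a0 ham; split=> [amf|[q ->]]; last first.
  by exists (allones_poly a * q); rewrite !Xn_sub1E; ring.
have [[u v] /= uv] := coprimeP m a0 ham.
have [A AE] := principal_ideal_Xn_sub1 a u.
have [B BE] := principal_ideal_Xn_sub1 m v.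
(* Bezout in the exponents: au = mv + 1 gives X - 1 = (X^(au) - 1) - X (X^(mv) - 1). *)
have X1E : 'X - 1 = ('X^a - 1) * A - ('X^m - 1) * ('X * B) :> {poly int}.
  have uaE : (a * u = (m * v).+1)%N by lia.
  by rewrite mulrCA -AE -BE uaE exprS; ring.
have [q qE] : principal_ideal ('X^m - 1) (('X - 1) * f).
  have -> : ('X - 1) * f =
      A * (('X^a - 1) * f) + (- ('X * B * f)) * ('X^m - 1).
    by rewrite X1E; ring.
  by apply: principal_idealD; apply: principal_idealMl => //; exists 1; rewrite mulr1.
(* Since X^m - 1 = (X - 1) C_m, cancelling the nonzero factor X - 1 in the domain Z[x] leaves f =
   C_m q. *)
exists q; apply: (@mulfI _ ('X - 1)); first by rewrite polyXsubC_eq0.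
by rewrite qE Xn_sub1E mulrA.
Qed.

(** * The identity between the Apery set and the gaps *)

Lemma Apery_gaps_perm (S : set nat) (a : nat) :
  numerical_semigroup S -> S a ->
  perm_eq (fset_set (Apery S a) ++ fset_set (gaps S))
          ([seq (a + n)%N | n <- fset_set (gaps S)] ++ iota 0 a).
Proof.
move=> nS Sa; have fA := finite_Apery a nS; have fG := finite_gaps nS.
have inA n : (n \in (fset_set (Apery S a) : seq nat)) = (n \in Apery S a).
  exact: in_fset_set.
have inG n : (n \in (fset_set (gaps S) : seq nat)) = (n \in gaps S).
  exact: in_fset_set.
apply: uniq_perm.
- rewrite cat_uniq !fset_uniq andbT; apply/hasPn => n.
  by rewrite inG inA => /set_mem nSn; apply/negP => /set_mem[].
- rewrite cat_uniq iota_uniq map_inj_uniq; last exact: addnI.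
  rewrite fset_uniq andbT; apply/hasPn => n; rewrite mem_iota add0n => /= lt_na.
  by apply/negP => /mapP[k _ nE]; rewrite nE ltnNge leq_addr in lt_na.
(* Both lists enumerate, without repetition, the n with n < a or n - a outside [S]. On the left, a
   gap n >= a qualifies because n - a in [S] would put n = a + (n - a) in [S]. *)
move=> n; rewrite !mem_cat mem_iota add0n /= inA inG; apply/orP/orP.
  case=> [/set_mem[Sn nSna]|/set_mem nSn]; have [lt_na|le_an] := ltnP n a;
    try by right.
    left; apply/mapP; exists (n - a)%N; last by rewrite subnKC.
    by rewrite inG; apply/mem_set => Sna; exact: nSna.
  left; apply/mapP; exists (n - a)%N; last by rewrite subnKC.
  by rewrite inG; apply/mem_set => Sna; apply: nSn; rewrite -(subnKC le_an); exact: nsgD.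
case=> [/mapP[k]|lt_na].
  rewrite inG => /set_mem nSk ->; have [Sak|nSak] := pselect (S (a + k)%N).
    by left; apply/mem_set; split=> // -[_]; rewrite addKn.
  by right; apply/mem_set.
have [Sn|nSn] := pselect (S n); last by right; apply/mem_set.
by left; apply/mem_set; split=> // -[]; rewrite leqNgt lt_na.
Qed.

Lemma Apery_polyE (S : set nat) (a : nat) :
  numerical_semigroup S -> S a ->
  \sum_(n <- fset_set (Apery S a)) 'X^n - \sum_(0 <= n < a) 'X^n =
  ('X^a - 1) * \sum_(n <- fset_set (gaps S)) 'X^n :> {poly int}.
Proof.
move=> nS Sa; have := perm_big _ (Apery_gaps_perm nS Sa) (P := predT)
  (F := fun n => 'X^n : {poly int}) (op := +%R) (x := 0).
rewrite !big_cat /= big_map.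
under [in RHS]eq_bigr do rewrite exprD.
rewrite -mulr_sumr /index_iota subn0 => AE.
by apply/eqP; rewrite mulrBl mul1r subr_eq addrAC eq_sym subr_eq eq_sym AE.
Qed.

(** * From multisets of integers to residue counts of naturals *)

Lemma nres_mset_of_intset (A : set nat) (r m : nat) : finite_set A ->
  nres r m (mset_of (intset A)) = residue_count m (fset_set A) r.
Proof.
move=> fA; rewrite /nres /mset_of (permP (perm_eq_seq_mset _)).
have perm_A : perm_eq (fset_set (intset A)) [seq Posz n | n <- fset_set A].
  rewrite /intset fset_set_image //; apply: uniq_perm; first exact: fset_uniq.
    by rewrite map_inj_uniq ?fset_uniq // => x y [].
  by move=> x; apply/imfsetP/mapP => -[n nA ->]; exists n.
rewrite (permP perm_A) count_map; apply: eq_count => n /=.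
by rewrite !modz_nat eqz_nat.
Qed.

Lemma mset_congr_intsetP (A B : set nat) (m : nat) :
  finite_set A -> finite_set B -> (0 < m)%N ->
  mset_congr m (mset_of (intset A)) (mset_of (intset B)) <->
  residue_count m (fset_set A) =1 residue_count m (fset_set B).
Proof.
move=> fA fB m0; split=> [AB r|AB r _]; last by rewrite !nres_mset_of_intset.
(* Representatives range over 1, ..., m, so the class of 0 is reached through [m] and every other
   class through its remainder. *)
have [r0|r0] := posnP (r %% m)%N.
  have := AB m; rewrite m0 leqnn !nres_mset_of_intset // => /(_ isT).
  by rewrite -(residue_count_mod _ _ m) -(residue_count_mod _ _ r)
    -[in X in _ = X -> _]residue_count_mod modnn -r0 !residue_count_mod.
have := AB (r %% m)%N; rewrite r0 ltnW ?ltn_pmod // => /(_ isT).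
by rewrite !nres_mset_of_intset // !residue_count_mod.
Qed.

Lemma equidistributed_intsetP (A : set nat) (m : nat) :
  finite_set A -> (0 < m)%N ->
  equidistributed m (mset_of (intset A)) <->
  forall r1 r2, residue_count m (fset_set A) r1 = residue_count m (fset_set A) r2.
Proof.
move=> fA m0; split=> [eqA|eqA r1 r2 _ _]; last by rewrite !nres_mset_of_intset.
(* All counts are compared with that of [m], the representative of the class of 0 in 1, ..., m. *)
suff eqm r : residue_count m (fset_set A) r = residue_count m (fset_set A) m.
  by move=> r1 r2; rewrite !eqm.
rewrite -residue_count_mod; have [->|r0] := posnP (r %% m)%N.
  by rewrite -[RHS]residue_count_mod modnn.
rewrite -!nres_mset_of_intset //; apply: eqA; first by rewrite r0 ltnW ?ltn_pmod.
by rewrite m0 leqnn.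
Qed.

Lemma int_intervalE (a : nat) : int_interval 0 (a%:Z - 1) = intset `I_a.
Proof.
apply/seteqP; split=> x /=; rewrite /int_interval /=.
  by case: x => // n lt_na; exists n => //=; lia.
by move=> [n /= lt_na <-]; lia.
Qed.

Lemma int_interval1E (a : nat) :
  int_interval 1 (a%:Z - 1) = intset (`I_a `\ 0%N).
Proof.
apply/seteqP; split=> x /=; rewrite /int_interval /=.
  by case: x => // n lt_na; exists n => //=; split; lia.
by move=> [n [/= lt_na n0] <-]; lia.
Qed.

Lemma perm_fset_set_II (a : nat) : perm_eq (fset_set `I_a) (index_iota 0 a).
Proof.
apply: uniq_perm; rewrite ?fset_uniq ?iota_uniq // => n.
rewrite mem_index_iota /= in_fset_set; last exact: finite_II.
by apply/idP/idP => [/set_mem|lt_na]; last exact: mem_set.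
Qed.

Lemma perm_fset_setD1 (T : choiceType) (A : set T) (x : T) : finite_set A ->
  A x -> perm_eq (fset_set A) (x :: fset_set (A `\ x)).
Proof.
move=> fA Ax; have fAx : finite_set (A `\ x) by exact: finite_setD.
apply: uniq_perm; first exact: fset_uniq.
  rewrite cons_uniq fset_uniq andbT; apply/negP.
  by rewrite in_fset_set // => /set_mem[_]; apply.
move=> y; rewrite inE !in_fset_set //; apply/idP/orP.
  move=> /set_mem Ay; have [->|yx] := eqVneq y x; first by left.
  by right; apply/mem_set; split=> //; apply/eqP.
by case=> [/eqP->|/set_mem[Ay _]]; apply/mem_set.
Qed.

Theorem proposition3p9 (S : set nat) (a m : nat)
    (hS : numerical_semigroup S) (haS : S a) (ha : a <> 0%N)
    (hm : (0 < m)%N) (ham : coprime a m) :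
  [<-> equidistributed m (mset_of (intset (gaps S)));
       principal_ideal (allones_poly m) (mset_poly (mset_of (gaps S)));
       poly_congr ('X^m - 1)
         (\sum_(n <- fset_set (Apery S a)) 'X^n) (\sum_(0 <= n < a) 'X^n);
       poly_congr ('X^m - 1)
         (\sum_(n <- fset_set (Apery S a `\ 0%N)) 'X^n)
         (\sum_(1 <= n < a) 'X^n);
       mset_congr m (mset_of (intset (Apery S a)))
         (mset_of (int_interval 0 (a%:Z - 1)));
       mset_congr m (mset_of (intset (Apery S a `\ 0%N)))
         (mset_of (int_interval 1 (a%:Z - 1)))].
Proof.
have a0 : (0 < a)%N by rewrite lt0n; apply/eqP.
have fA := finite_Apery a hS; have fG := finite_gaps hS.
have fI : finite_set `I_a := finite_II a.
have fA0 : finite_set (Apery S a `\ 0%N) by exact: finite_setD.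
have fI0 : finite_set (`I_a `\ 0%N) by exact: finite_setD.
have A0 : Apery S a 0%N.
  by split=> [|[]]; [exact: nsg0 | rewrite leqNgt a0].
have e12 := iff_trans (equidistributed_intsetP fG hm)
  (iff_sym (allones_poly_idealP (fset_set (gaps S)) hm)).
have e23 := coprime_allones_poly_ideal
  (\sum_(n <- fset_set (gaps S)) 'X^n) a0 ham.
(* The product of X^a - 1 with the gap polynomial is the difference of the two sides of (3), so
   [e23] becomes the equivalence of (3) and (2). *)
rewrite -(Apery_polyE hS haS) -/(poly_congr _ _ _) in e23.
(* Both sums contain the term X^0, as 0 lies in the Apery set and a > 0; it cancels in the
   difference. *)
have e34 : poly_congr ('X^m - 1)
      (\sum_(n <- fset_set (Apery S a)) 'X^n) (\sum_(0 <= n < a) 'X^n) <->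
    poly_congr ('X^m - 1)
      (\sum_(n <- fset_set (Apery S a `\ 0%N)) 'X^n) (\sum_(1 <= n < a) 'X^n).
  rewrite /poly_congr (perm_big _ (perm_fset_setD1 fA A0)) big_cons.
  by rewrite big_ltn // opprD addrACA subrr add0r.
have perm_I0 : perm_eq (fset_set (`I_a `\ 0%N)) (index_iota 1 a).
  rewrite -(perm_cons 0%N) -(permPl (perm_fset_setD1 fI a0)).
  by rewrite (permPl (perm_fset_set_II a)) /index_iota subn0 -{1}(prednK a0) subn1.
have e35 : poly_congr ('X^m - 1)
      (\sum_(n <- fset_set (Apery S a)) 'X^n) (\sum_(0 <= n < a) 'X^n) <->
    mset_congr m (mset_of (intset (Apery S a)))
      (mset_of (int_interval 0 (a%:Z - 1))).
  rewrite int_intervalE mset_congr_intsetP // -poly_congr_Xn_sub1P //.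
  by rewrite (perm_big _ (perm_fset_set_II a)).
have e46 : poly_congr ('X^m - 1)
      (\sum_(n <- fset_set (Apery S a `\ 0%N)) 'X^n) (\sum_(1 <= n < a) 'X^n) <->
    mset_congr m (mset_of (intset (Apery S a `\ 0%N)))
      (mset_of (int_interval 1 (a%:Z - 1))).
  rewrite int_interval1E mset_congr_intsetP // -poly_congr_Xn_sub1P //.
  by rewrite (perm_big _ perm_I0).
have gapsE : mset_poly (mset_of (gaps S)) = \sum_(n <- fset_set (gaps S)) 'X^n.
  exact/perm_big/perm_eq_seq_mset.
(* The equivalences 1-2, 2-3, 3-4, 3-5 and 4-6 form a tree on the six statements, so the rest is
   propositional. *)
by rewrite gapsE; tfae; tauto.
Qed.
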